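(* For $B\in\mathbb{R}$ let $A(x):=\frac B2(-x_2,x_1)$ and consider the minimisation problem $$\mu:=\inf_{u\in W_0^{1,2}(\Omega_1),\ u\neq0}\frac{2\,\|\partial_1^Au\|\,\|\partial_2^Au\|}{\|u\|^2}.$$ Suppose that, for every $B\in\mathbb{R}$, there exists a minimiser $u$ of this problem (that is, $u\in W_0^{1,2}(\Omega_1)$, $u\ne0$, attaining the infimum $\mu$) which satisfies $\|\partial_1^Au\|=\|\partial_2^Au\|$. Then for every $a>0$ and every $B\in\mathbb{R}$, $$\lambda_1^B(\Omega_a)\ \ge\ \lambda_1^B(\Omega_1).$$
   Context: For $a>0$ let $\Omega_a:=\left(-\frac a2,\frac a2\right)\times\left(-\frac1{2a},\frac1{2a}\right)\subset\mathbb{R}^2$ (so $\Omega_1$ is the unit square centred at the origin). $\|\cdot\|$ denotes the norm of $L^2(\Omega_1)$ (complex-valued functions), and $\partial_k^A:=\partial_k-iA_k$ for $k\in\{1,2\}$. For $B\in\mathbb{R}$, $\lambda_1^B(\Omega_a)$ denotes the lowest eigenvalue of the magnetic Dirichlet Laplacian $(-i\nabla-A)^2$ on $\Omega_a$ with constant magnetic field $\operatorname{curl}A=\partial_1A_2-\partial_2A_1=B$, i.e. of the self-adjoint operator in $L^2(\Omega_a)$ associated with the quadratic form $u\mapsto\|(\partial_1-iA_1)u\|_{L^2(\Omega_a)}^2+\|(\partial_2-iA_2)u\|_{L^2(\Omega_a)}^2$ with domain $W_0^{1,2}(\Omega_a)$; it does not depend on the choice of smooth $A:\overline{\Omega_a}\to\mathbb{R}^2$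 with $\operatorname{curl}A=B$. *)

(* Defs.v *)
From HB Require Import structures.
From mathcomp Require Import all_boot all_order all_algebra.
From mathcomp Require Import all_classical all_reals all_analysis.
From mathcomp Require Import complex.

Set Implicit Arguments.
Unset Strict Implicit.
Unset Printing Implicit Defensive.

Import Order.TTheory GRing.Theory Num.Theory.
Import numFieldNormedType.Exports.

Local Open Scope classical_set_scope.
Local Open Scope ring_scope.
Local Open Scope complex_scope.

Section Plane.
Context {R : realType}.
Local Notation plane := (R * R)%type.
Implicit Types (D : set plane) (k : 'I_2) (x : plane) (f g : plane -> R[i]).

Definition leb2 : {measure set (measurableTypeR R * measurableTypeR R) -> \bar R} :=
  (@lebesgue_measure R \x @lebesgue_measure R)%E.

(* In 'I_2, 0 and 1 stand for the coordinate indices 1 and 2. *)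
Definition axis k : plane := if k == 0 then (1, 0) else (0, 1).

Fixpoint Ck_fun (n : nat) (h : plane -> R) : Prop :=
  if n is m.+1 then
    continuous h /\
    forall k, (forall x, derivable h x (axis k)) /\ Ck_fun m ('D_(axis k) h)
  else continuous h.

(* C_c^oo(D), complex-valued. *)
Definition test_fun D f : Prop :=
  [/\ forall n, Ck_fun n (fun x => complex.Re (f x)) /\ Ck_fun n (fun x => complex.Im (f x)),
      compact (closure [set x | f x != 0]) &
      closure [set x | f x != 0] `<=` D].

Definition cpartial k f : plane -> R[i] := fun x =>
  'D_(axis k) (fun y => complex.Re (f y)) x +i* 'D_(axis k) (fun y => complex.Im (f y)) x.

Definition cintegral D f : R[i] :=
  Rintegral leb2 D (fun x => complex.Re (f x)) +i* Rintegral leb2 D (fun x => complex.Im (f x)).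

Definition sqmod (z : R[i]) : R := complex.Re z ^+ 2 + complex.Im z ^+ 2.

Definition in_L2 D f : Prop :=
  [/\ measurable_fun (D : set (measurableTypeR R * measurableTypeR R))
        (fun x => complex.Re (f x)),
      measurable_fun (D : set (measurableTypeR R * measurableTypeR R))
        (fun x => complex.Im (f x)) &
      leb2.-integrable D (fun x => (sqmod (f x))%:E)].

Definition inner_L2 D f g : R[i] := cintegral D (fun x => f x * (g x)^*).

Definition norm_L2 D f : R := Num.sqrt (Rintegral leb2 D (fun x => sqmod (f x))).

Definition zero_L2 D f : Prop := {ae leb2, forall x, D x -> f x = 0}.

Definition weak_partial D k f g : Prop :=
  forall phi, test_fun D phi ->
    cintegral D (fun x => f x * cpartial k phi x) =
    - cintegral D (fun x => g x * phi x).

(* W_0^{1,2}(D), the closure of C_c^oo(D) in W^{1,2}(D).  An element is a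
   representative of the L^2 class together with representatives of its weak
   partial derivatives; the latter are determined up to null sets, and only
   the values on D matter. *)
Record W012 D := MkW012 {
  wfun :> plane -> R[i];
  wgrad : 'I_2 -> plane -> R[i];
  wfun_L2 : in_L2 D wfun;
  wgrad_L2 : forall k, in_L2 D (wgrad k);
  wgrad_weak : forall k, weak_partial D k wfun (wgrad k);
  wfun_closure : exists phi : nat -> plane -> R[i],
    [/\ forall n, test_fun D (phi n),
        norm_L2 D (fun x => phi n x - wfun x) @[n --> \oo] --> 0 &
        forall k, norm_L2 D (fun x => cpartial k (phi n) x - wgrad k x)
                    @[n --> \oo] --> 0] }.

Definition Omega (a : R) : set plane :=
  `](- (a / 2)), (a / 2)[ `*` `](- (2 * a)^-1), (2 * a)^-1[.

(* The symmetric gauge A(x) = B/2 (-x_2, x_1), with curl A = B. *)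
Definition potential (B : R) k x : R :=
  if k == 0 then B / 2 * - x.2 else B / 2 * x.1.

Definition mag_partial (B : R) D k (u : W012 D) : plane -> R[i] :=
  fun x => wgrad u k x - 'i * (potential B k x)%:C * u x.

Definition mag_form (B : R) D (u v : W012 D) : R[i] :=
  \sum_(k < 2) inner_L2 D (mag_partial B k u) (mag_partial B k v).

(* The graph of the operator associated with the form: u is in its domain and
   is mapped to f. *)
Definition mag_laplacian (B : R) D (u : W012 D) f : Prop :=
  in_L2 D f /\ forall v : W012 D, mag_form B u v = inner_L2 D f v.

(* The operator is self-adjoint, so only real eigenvalues occur. *)
Definition mag_eigenvalue (B : R) D (l : R) : Prop :=
  exists u : W012 D, ~ zero_L2 D u /\ mag_laplacian B u (fun x => l%:C * u x).

(* The spectrum on a bounded domain is discrete and bounded below, so the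
   infimum is a minimum: it is the lowest eigenvalue. *)
Definition lambda1 (B : R) D : \bar R :=
  ereal_inf [set l%:E | l in mag_eigenvalue B D].

Definition mu_quotient (B : R) D (u : W012 D) : R :=
  2 * norm_L2 D (mag_partial B 0 u) * norm_L2 D (mag_partial B 1 u)
  / norm_L2 D u ^+ 2.

Definition mu (B : R) : R :=
  inf [set q | exists2 u : W012 (Omega 1), ~ zero_L2 (Omega 1) u &
                                            q = mu_quotient B u].

Definition mu_minimiser (B : R) (u : W012 (Omega 1)) : Prop :=
  ~ zero_L2 (Omega 1) u /\ mu_quotient B u = mu B.

End Plane.

(* Main.v *)
Require Import Defs.
From mathcomp Require Import all_boot all_order all_algebra.
From mathcomp Require Import all_classical all_reals all_analysis.
From mathcomp Require Import complex.
From mathcomp Require Import measurable_realfun ring lra.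

(** Both eigenvalues are compared with the number mu, the infimum of
    2 |d_1 u| |d_2 u| / |u|^2 over the unit square, where d_k is the magnetic
    derivative and the bars are norms of L^2.

    Lower bound on the rectangle.  The map S (x_1, x_2) = (a x_1, x_2 / a) carries
    the unit square onto the rectangle and preserves area.  In the symmetric
    gauge the k-th component of the potential at x is its value at S x times the
    k-th stretching factor, so that d_1 (u o S) = a (d_1 u) o S and
    d_2 (u o S) = (1 / a) (d_2 u) o S.  The product |d_1 u| |d_2 u| is therefore
    unchanged when u on the rectangle is replaced by u o S on the square.  For an
    eigenfunction u with eigenvalue l, the inequality 2 p q <= p^2 + q^2 gives
    mu |u|^2 <= 2 |d_1 u| |d_2 u| <= |d_1 u|^2 + |d_2 u|^2 = l |u|^2; this is
    [mu_le_eigenvalue].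

    Upper bound on the square.  The same inequality shows that
    |d_1 w|^2 + |d_2 w|^2 >= mu |w|^2 for every w, and a minimiser with
    |d_1 u| = |d_2 u| turns it into an equality.  Such a minimiser thus minimises
    the Rayleigh quotient of the magnetic Laplacian, and varying it along u + c v
    with complex c yields the eigenvalue equation: mu is itself an eigenvalue of
    the square ([minimiser_eigenvalue]).

    Both steps rely on the stability of W_0^{1,2} under linear combinations
    ([W012_lincomb]) and under composition with S ([W012_squeeze]), hence on
    elementary L^2 calculus, on the invariance of the planar Lebesgue measure
    under S ([leb2_squeeze]), and on the measurability of continuous functions for the product
    sigma-algebra ([continuous_measurable_plane]). *)

Set Implicit Arguments.
Unset Strict Implicit.
Unset Printing Implicit Defensive.
Import Order.TTheory GRing.Theory Num.Theory.
Import numFieldNormedType.Exports.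

Local Open Scope classical_set_scope.
Local Open Scope ring_scope.
Local Open Scope complex_scope.

(** * Measure on the plane and the area-preserving squeeze *)

Section Scaling.
Context {R : realType}.
Local Notation plane := (R * R)%type.
Local Notation mplane := (measurableTypeR R * measurableTypeR R)%type.
Local Notation mu1 := (@lebesgue_measure R).

(** By uniqueness of Lebesgue measure: c times the push-forward under
    multiplication by c gives each half-open interval its length. *)
Lemma lebesgue_measure_scale (c : R) (A : set (measurableTypeR R)) :
  0 < c -> measurable A ->
  mu1 [set x : measurableTypeR R | A (c * x : R)] = (c^-1%:E * mu1 A)%E.
Proof.
move=> c0 mA.
have mc : measurable_fun setT ((fun x => c * x) : measurableTypeR R -> measurableTypeR R).
  exact: mulrl_measurable.
have cge0 : 0 <= c by exact: ltW.
pose m : {measure set (measurableTypeR R) -> \bar R} :=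
  mscale (NngNum cge0) (measure_function_pushforward__canonical__measure_function_Measure mu1 mc).
suff -> : mu1 A = m A.
  by rewrite /m/= /mscale/= muleA -EFinM mulVf ?gt_eqF// mul1e.
apply: lebesgue_measure_unique => // _ [[x y] _ <-].
rewrite /m/= /mscale/= /pushforward.
have -> : (fun z : R => c * z) @^-1` `]x, y] = `]c^-1 * x, c^-1 * y]%classic.
  apply/seteqP; split=> z /=; rewrite !in_itv/= !(mulrC c^-1) ltr_pdivrMr// ler_pdivlMr//;
  by rewrite (mulrC z).
rewrite !lebesgue_measure_itv/= !lte_fin ltr_pM2l ?invr_gt0//.
case: ifP => _; last by rewrite mule0.
by rewrite -!EFinD -EFinM; congr (_%:E); field; rewrite gt_eqF.
Qed.

(** Only products of measurable sets generate the product sigma-algebra; an open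
    set belongs to it because it is the union of the countably many rational
    open boxes that it contains. *)
Lemma open_measurable_plane (U : set plane) : open U -> measurable (U : set mplane).
Proof.
move=> oU.
pose box (q : rat * rat * (rat * rat)) : set mplane :=
  (`]ratr q.1.1, ratr q.1.2[ `*` `]ratr q.2.1, ratr q.2.2[)%classic.
(* Boxes that leave U are replaced by the empty set, so that the union can run
   over all rational quadruples. *)
pose F q : set mplane := if pselect (box q `<=` U) then box q else set0.
have -> : U = \bigcup_q F q.
  apply/seteqP; split => [[x y] Uxy|z [q _]]; last first.
    by rewrite /F; case: pselect => // boxU /boxU.
  have : nbhs (x, y) U by rewrite nbhsE /=; exists U.
  case=> -[A B] /= [/nbhs_ballP[_/posnumP[e] eA] /nbhs_ballP[_/posnumP[d] dB]] AB.
  have bnd (z : R) (r : {posnum R}) : exists p q : rat,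
      [/\ ratr p < z, z < ratr q & forall t, ratr p < t -> t < ratr q -> ball z r%:num t].
    have [p + [q]] : exists2 p : rat, ratr p \in `]z - r%:num, z[ &
        exists q : rat, ratr q \in `]z, z + r%:num[.
      have [|p ?] := @rat_in_itvoo R (z - r%:num) z; first by rewrite ltrBlDr ltrDl.
      by exists p => //; apply: rat_in_itvoo; rewrite ltrDl.
    rewrite !in_itv/= => /andP[rp pz] /andP[zq qr]; exists p, q; split => // t pt tq.
    by rewrite /ball/= ltr_norml; apply/andP; split; lra.
  have [p [q [px xq pqA]]] := bnd x e.
  have [p' [q' [py yq pqB]]] := bnd y d.
  exists ((p, q), (p', q')) => //; rewrite /F; case: pselect => /= [_|].
    by split; rewrite /= in_itv/= ?px ?py.
  move=> nbU; exfalso; apply: nbU => -[s t] [/=].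
  rewrite !in_itv/= => /andP[? ?] /andP[? ?].
  by apply: AB; split => /=; [apply/eA/pqA | apply/dB/pqB].
apply: countable_bigcupT_measurable => // q; rewrite /F.
case: pselect => /= [_|_]; last exact: measurable0.
by apply: measurableX; exact: measurable_itv.
Qed.

Lemma continuous_measurable_plane (D : set plane) (h : plane -> R) :
  continuous h -> measurable_fun (D : set mplane) h.
Proof.
move=> ch; suff : measurable_fun (setT : set mplane) h by exact: measurable_funTS.
move=> mT; apply: (measurability _ (RGenOpens.measurableE R)) => //.
move=> _ [_ [x [y ->] <-]].
rewrite setTI; apply: open_measurable_plane.
by move/continuousP : ch; apply; exact: interval_open.
Qed.

Lemma measurable_Omega (a : R) : measurable (Omega a : set mplane).
Proof. by apply: measurableX; exact: measurable_itv. Qed.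

Lemma leb2X (A B : set (measurableTypeR R)) : measurable A -> measurable B ->
  leb2 (A `*` B) = (mu1 A * mu1 B)%E.
Proof. exact: product_measure1E. Qed.

Lemma leb2_Omega (a : R) : (leb2 (Omega a) < +oo)%E.
Proof.
rewrite /Omega leb2X; [|exact: measurable_itv..].
rewrite !lebesgue_measure_itv/=.
by do 2 case: ifP => _; rewrite ?mule0 ?mul0e// -!EFinD -EFinM ltry.
Qed.

(** For a > 0 this linear map of determinant 1 carries the unit square onto
    the rectangle Omega a. *)
Definition squeeze (a : R) (x : plane) : plane := (a * x.1, a^-1 * x.2).

Lemma squeezeK (a : R) : 0 < a -> cancel (squeeze a) (squeeze a^-1).
Proof.
by move=> a0 [x y]; rewrite /squeeze/= invrK mulVKf ?mulKf ?gt_eqF.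
Qed.

Lemma squeezeVK (a : R) : 0 < a -> cancel (squeeze a^-1) (squeeze a).
Proof. by move=> a0; rewrite -{2}(invrK a); apply: squeezeK; rewrite invr_gt0. Qed.

Lemma squeeze_continuous (a : R) : continuous (squeeze a).
Proof.
move=> [x y].
apply: (@cvg_pair _ _ _ (nbhs (x, y)) (nbhs (a * x)) (nbhs (a^-1 * y))).
  by apply: cvgM; [exact: cvg_cst|exact: cvg_fst].
by apply: cvgM; [exact: cvg_cst|exact: cvg_snd].
Qed.

Lemma measurable_squeeze (a : R) :
  measurable_fun setT (squeeze a : mplane -> mplane).
Proof.
apply: measurable_fun_pair.
  apply: (measurableT_comp (mulrl_measurable _)); exact: measurable_fst.
apply: (measurableT_comp (mulrl_measurable _)); exact: measurable_snd.
Qed.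

(** The two one-dimensional scaling factors, 1 / a and a, cancel on products of
    measurable sets, and a sigma-finite product measure is determined by these. *)
Lemma leb2_squeeze (a : R) (X : set mplane) : 0 < a -> measurable X ->
  pushforward leb2 (squeeze a : mplane -> mplane) X = leb2 X.
Proof.
move=> a0 mX.
pose m := measure_function_pushforward__canonical__measure_function_Measure leb2
  (measurable_squeeze a).
apply/esym; apply: (product_measure_unique (m' := m)) => // A B mA mB.
rewrite /m/= /pushforward.
have -> : squeeze a @^-1` (A `*` B) =
   [set x : measurableTypeR R | A (a * x : R)] `*`
   [set x : measurableTypeR R | B (a^-1 * x : R)] by [].
have mscaled (c : R) (C : set (measurableTypeR R)) : measurable C ->
    measurable [set x : measurableTypeR R | C (c * x : R)].
  by move=> mC; rewrite -[X in measurable X]setTI; exact: mulrl_measurable.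
rewrite !leb2X//; [|exact: mscaled..].
rewrite !lebesgue_measure_scale ?invr_gt0// invrK muleACA -EFinM.
by rewrite mulVf ?gt_eqF// mul1e.
Qed.

Lemma squeeze_Omega (a : R) : 0 < a -> squeeze a @^-1` Omega a = Omega 1.
Proof.
move=> a0; rewrite /Omega !invfM invr1 mul1r mulr1.
(* All four bounds are now a or 1 / a times those of the unit square. *)
rewrite (mulrC 2^-1) -!mulrN.
by apply/seteqP; split => -[x y] /=; rewrite !in_itv/= !ltr_pM2l ?invr_gt0.
Qed.

Lemma measurable_preimage_squeeze (a : R) (D : set mplane) :
  measurable D -> measurable (squeeze a @^-1` D : set mplane).
Proof.
by move=> mD; rewrite -[X in measurable X]setTI; exact: measurable_squeeze.
Qed.

Lemma measurable_fun_squeeze d (T : measurableType d) (a : R) (D : set mplane)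
    (f : mplane -> T) : measurable D -> measurable_fun D f ->
  measurable_fun (squeeze a @^-1` D : set mplane) (f \o squeeze a).
Proof.
move=> mD mf; apply: (measurable_comp mD) => //; first by move=> _ [x Dx <-].
by apply: measurable_funTS; exact: measurable_squeeze.
Qed.

Lemma ge0_integral_squeeze (a : R) (D : set mplane) (f : mplane -> \bar R) :
  0 < a -> measurable D -> measurable_fun D f -> (forall x, 0 <= f x)%E ->
  (\int[leb2]_(x in squeeze a @^-1` D) (f \o squeeze a) x =
   \int[leb2]_(x in D) f x)%E.
Proof.
move=> a0 mD mf f0.
rewrite -(ge0_integral_pushforward (measurable_squeeze a) leb2 mD mf (fun _ _ => f0 _)).
apply: eq_measure_integral; first exact: measurable_squeeze.
by move=> msq A mA _; exact: leb2_squeeze.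
Qed.

Lemma integrable_squeeze (a : R) (D : set mplane) (f : mplane -> \bar R) :
  0 < a -> measurable D -> leb2.-integrable D f ->
  leb2.-integrable (squeeze a @^-1` D) (f \o squeeze a).
Proof.
move=> a0 mD /integrableP[mf fi]; apply/integrableP; split.
  exact: measurable_fun_squeeze.
rewrite (ge0_integral_squeeze (f := fun x => `|f x|%E))//.
exact: measurableT_comp.
Qed.

(** The positive and the negative part are transported separately; each is a
    nonnegative integral, where measurability is enough. *)
Lemma Rintegral_squeeze (a : R) (D : set mplane) (f : mplane -> R) :
  0 < a -> measurable D -> measurable_fun D f ->
  Rintegral leb2 (squeeze a @^-1` D) (f \o squeeze a) = Rintegral leb2 D f.
Proof.
move=> a0 mD mf; rewrite /Rintegral; congr fine.
have mE : measurable_fun D (EFin \o f) by exact/measurable_EFinP.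
rewrite integralE [in RHS]integralE; apply: (f_equal2 (fun y z => y - z)%E).
- rewrite -(ge0_integral_squeeze a0 mD (measurable_funepos mE))//.
  by apply: eq_integral => x _; rewrite -[RHS]/((_ \o squeeze a) x) -funepos_comp.
- rewrite -(ge0_integral_squeeze a0 mD (measurable_funeneg mE))//.
  by apply: eq_integral => x _; rewrite -[RHS]/((_ \o squeeze a) x) -funeneg_comp.
Qed.

End Scaling.

(** * Real and imaginary parts *)

Section ComplexParts.
Context {R : realType}.
Implicit Types z w c : R[i].

Lemma cReD z w : complex.Re (z + w) = complex.Re z + complex.Re w.
Proof. by case: z => ? ?; case: w. Qed.
Lemma cImD z w : complex.Im (z + w) = complex.Im z + complex.Im w.
Proof. by case: z => ? ?; case: w. Qed.
Lemma cReN z : complex.Re (- z) = - complex.Re z. Proof. by case: z. Qed.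
Lemma cImN z : complex.Im (- z) = - complex.Im z. Proof. by case: z. Qed.
Lemma cReM z w : complex.Re (z * w) =
  complex.Re z * complex.Re w - complex.Im z * complex.Im w.
Proof. by case: z => ? ?; case: w. Qed.
Lemma cImM z w : complex.Im (z * w) =
  complex.Re z * complex.Im w + complex.Im z * complex.Re w.
Proof. by case: z => ? ?; case: w. Qed.
Lemma cReJ z : complex.Re z^* = complex.Re z. Proof. by case: z. Qed.
Lemma cImJ z : complex.Im z^* = - complex.Im z. Proof. by case: z. Qed.
Lemma cReR (r : R) : complex.Re r%:C = r. Proof. by []. Qed.
Lemma cImR (r : R) : complex.Im r%:C = (0 : R). Proof. by []. Qed.
Lemma cReZ (r : R) z : complex.Re (r%:C * z) = r * complex.Re z.
Proof. by case: z => x y /=; rewrite mul0r subr0. Qed.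
Lemma cImZ (r : R) z : complex.Im (r%:C * z) = r * complex.Im z.
Proof. by case: z => x y /=; rewrite mul0r addr0. Qed.
Lemma cRei : complex.Re ('i : R[i]) = (0 : R). Proof. by []. Qed.
Lemma cImi : complex.Im ('i : R[i]) = (1 : R). Proof. by []. Qed.

(** The order matters: the pattern of [cReR] matches, up to conversion, any term
    that reduces to an explicit complex number, so the structural rules must be
    tried before it. *)
Definition complex_parts := (cRei, cImi, cReD, cImD, cReN, cImN, cReM, cImM,
  cReJ, cImJ, cReR, cImR).

Lemma complex_ext z w :
  complex.Re z = complex.Re w -> complex.Im z = complex.Im w -> z = w.
Proof. by case: z => a b; case: w => c d /= -> ->. Qed.

Lemma sqmod_ge0 z : 0 <= sqmod z.
Proof. by rewrite addr_ge0 ?sqr_ge0. Qed.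

Lemma sqmod_eq0 z : sqmod z = 0 -> z = 0.
Proof.
move=> z0; have [z1 z2] : complex.Re z = 0 /\ complex.Im z = 0.
  by move/eqP: z0; rewrite paddr_eq0 ?sqr_ge0// !sqrf_eq0 => /andP[/eqP ? /eqP ?].
exact: complex_ext.
Qed.
End ComplexParts.

(** * Square-integrable functions *)

Section L2.
Context {R : realType}.
Local Notation plane := (R * R)%type.
Local Notation mplane := (measurableTypeR R * measurableTypeR R)%type.
Variables (D : set mplane) (mD : measurable D).
Implicit Types (p q : mplane -> R) (f g : plane -> R[i]).

Lemma eq_Rintegral_leb2 p q : p =1 q -> Rintegral leb2 D p = Rintegral leb2 D q.
Proof. by move=> /funext ->. Qed.

Definition real_L2 p := measurable_fun D p /\
  leb2.-integrable D (EFin \o (fun x => p x ^+ 2)).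

Lemma real_integrable_le p q : measurable_fun D p ->
  leb2.-integrable D (EFin \o q) -> (forall x, D x -> `|p x| <= q x) ->
  leb2.-integrable D (EFin \o p).
Proof.
move=> mp iq pq; apply: (le_integrable mD _ _ iq); first exact/measurable_EFinP.
by move=> x Dx /=; rewrite lee_fin (le_trans (pq x Dx))// ler_norm.
Qed.

Lemma real_integrableD p q : leb2.-integrable D (EFin \o p) ->
  leb2.-integrable D (EFin \o q) -> leb2.-integrable D (EFin \o (fun x => p x + q x)).
Proof. by move=> ip iq; have := integrableD mD ip iq. Qed.

Lemma real_integrableZ (k : R) p : leb2.-integrable D (EFin \o p) ->
  leb2.-integrable D (EFin \o (fun x => k * p x)).
Proof. by move=> ip; have := integrableZl mD k ip. Qed.

(** From |p q| <= p^2 + q^2. *)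
Lemma real_L2M p q : real_L2 p -> real_L2 q ->
  leb2.-integrable D (EFin \o (fun x => p x * q x)).
Proof.
move=> [mp ip] [mq iq].
apply: (real_integrable_le _ (real_integrableD ip iq)); first exact: measurable_funM.
move=> x _; rewrite ler_norml; apply/andP; split; nra.
Qed.

Lemma real_L2_bounded (M : R) p q : measurable_fun D p ->
  (forall x, D x -> `|p x| <= M) -> real_L2 q -> real_L2 (fun x => p x * q x).
Proof.
move=> mp pM [mq iq]; have mpq : measurable_fun D (fun x => p x * q x).
  exact: measurable_funM.
split=> //; apply: (real_integrable_le _ (real_integrableZ (M ^+ 2) iq)).
  exact: measurable_funX.
move=> x Dx /=; rewrite ger0_norm ?sqr_ge0// exprMn ler_wpM2r ?sqr_ge0//.
by rewrite -(real_normK (num_real (p x))) lerXn2r ?nnegrE// ?pM// (le_trans _ (pM x Dx)).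
Qed.

Lemma real_L2Z (k : R) p : real_L2 p -> real_L2 (fun x => k * p x).
Proof. by apply: (@real_L2_bounded `|k| (cst k)). Qed.

Lemma real_L2D p q : real_L2 p -> real_L2 q -> real_L2 (fun x => p x + q x).
Proof.
move=> Lp Lq; have [[mp ip] [mq iq]] := (Lp, Lq).
split; first exact: measurable_funD.
apply: (real_integrable_le _ (real_integrableZ 2 (real_integrableD ip iq))).
  by apply: measurable_funX; exact: measurable_funD.
move=> x _ /=; rewrite ger0_norm ?sqr_ge0// -subr_ge0.
by have := sqr_ge0 (p x - q x); congr (_ <= _); ring.
Qed.

(** Membership in L^2 is reduced to real functions, where sums and products can
    be dominated directly. *)
Lemma in_L2P f : in_L2 D f <->
  real_L2 (fun x => complex.Re (f x)) /\ real_L2 (fun x => complex.Im (f x)).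
Proof.
split=> [[mr mi fi]|[[mr ir] [mi ii]]].
  split; split=> //; apply: (real_integrable_le _ fi); try exact: measurable_funX.
  - by move=> x _; rewrite ger0_norm ?sqr_ge0// /sqmod lerDl sqr_ge0.
  - by move=> x _; rewrite ger0_norm ?sqr_ge0// /sqmod lerDr sqr_ge0.
by split=> //; exact: (real_integrableD ir ii).
Qed.

Lemma in_L2_bounded (M : R) (h : plane -> R[i]) f :
  measurable_fun D (fun x => complex.Re (h x)) ->
  measurable_fun D (fun x => complex.Im (h x)) ->
  (forall x, D x -> `|complex.Re (h x)| <= M) ->
  (forall x, D x -> `|complex.Im (h x)| <= M) ->
  in_L2 D f -> in_L2 D (fun x => h x * f x).
Proof.
move=> mr mi rM iM /in_L2P[Lr Li]; apply/in_L2P.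
have LM p q := @real_L2_bounded M p q.
split.
  under [X in real_L2 X]funext do rewrite cReM -mulN1r.
  by apply: real_L2D; [|apply: real_L2Z]; exact: LM.
under [X in real_L2 X]funext do rewrite cImM.
by apply: real_L2D; exact: LM.
Qed.

Lemma in_L2Z (c : R[i]) f : in_L2 D f -> in_L2 D (fun x => c * f x).
Proof.
apply: (@in_L2_bounded (`|complex.Re c| + `|complex.Im c|) (fun=> c)) => // x _.
  by rewrite lerDl.
by rewrite lerDr.
Qed.

Lemma in_L2D f g : in_L2 D f -> in_L2 D g -> in_L2 D (fun x => f x + g x).
Proof.
move=> /in_L2P[fr fi] /in_L2P[gr gi]; apply/in_L2P; split.
  by under [X in real_L2 X]funext do rewrite cReD; exact: real_L2D.
by under [X in real_L2 X]funext do rewrite cImD; exact: real_L2D.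
Qed.

Lemma in_L2_lincomb (c : R[i]) f g :
  in_L2 D f -> in_L2 D g -> in_L2 D (fun x => f x + c * g x).
Proof. by move=> Lf Lg; apply: in_L2D => //; exact: in_L2Z. Qed.

Lemma in_L2J f : in_L2 D f -> in_L2 D (fun x => (f x)^*).
Proof.
move=> /in_L2P[fr fi]; apply/in_L2P; split.
  by under [X in real_L2 X]funext do rewrite cReJ.
by under [X in real_L2 X]funext do rewrite cImJ -mulN1r; exact: real_L2Z.
Qed.

Definition cintegrable f :=
  leb2.-integrable D (EFin \o (fun x => complex.Re (f x))) /\
  leb2.-integrable D (EFin \o (fun x => complex.Im (f x))).

Lemma in_L2M f g : in_L2 D f -> in_L2 D g -> cintegrable (fun x => f x * g x).
Proof.
move=> /in_L2P[fr fi] /in_L2P[gr gi]; split.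
  under [X in EFin \o X]funext do rewrite cReM -mulN1r.
  by apply: real_integrableD; [|apply: real_integrableZ]; exact: real_L2M.
under [X in EFin \o X]funext do rewrite cImM.
by apply: real_integrableD; exact: real_L2M.
Qed.

Lemma Re_cintegral f :
  complex.Re (cintegral D f) = Rintegral leb2 D (fun x => complex.Re (f x)).
Proof. by []. Qed.
Lemma Im_cintegral f :
  complex.Im (cintegral D f) = Rintegral leb2 D (fun x => complex.Im (f x)).
Proof. by []. Qed.
Definition cintegral_parts := (Re_cintegral, Im_cintegral).

Lemma cintegral_lincomb (c : R[i]) f g : cintegrable f -> cintegrable g ->
  cintegral D (fun x => f x + c * g x) = cintegral D f + c * cintegral D g.
Proof.
move=> [fr fi] [gr gi]; apply: complex_ext; rewrite ?(complex_parts, cintegral_parts).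
  under eq_Rintegral do rewrite !complex_parts -mulNr.
  rewrite RintegralD//; last by apply: real_integrableD; exact: real_integrableZ.
  by rewrite RintegralD ?RintegralZl ?mulNr//; exact: real_integrableZ.
under eq_Rintegral do rewrite !complex_parts.
rewrite RintegralD//; last by apply: real_integrableD; exact: real_integrableZ.
by rewrite RintegralD ?RintegralZl//; exact: real_integrableZ.
Qed.

Lemma norm_L2_ge0 f : 0 <= norm_L2 D f.
Proof. exact: sqrtr_ge0. Qed.

Lemma sqr_norm_L2 f : norm_L2 D f ^+ 2 = Rintegral leb2 D (fun x => sqmod (f x)).
Proof. by rewrite sqr_sqrtr// Rintegral_ge0// => x _; exact: sqmod_ge0. Qed.

Lemma inner_L2_norm f : inner_L2 D f f = (norm_L2 D f ^+ 2)%:C.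
Proof.
rewrite sqr_norm_L2; apply: complex_ext; rewrite /inner_L2 cintegral_parts ?(cReR, cImR).
  by apply: eq_Rintegral_leb2 => x; rewrite !complex_parts /sqmod; ring.
rewrite (_ : (fun _ => _) = cst 0) ?Rintegral_cst ?mul0r//.
by apply/funext => x; rewrite !complex_parts /=; ring.
Qed.

(** The expansion of |f + c g|^2 that drives the variational argument; the
    cross term is the real part of conj(c) <f, g>. *)
Lemma sqr_norm_lincomb (c : R[i]) f g : in_L2 D f -> in_L2 D g ->
  norm_L2 D (fun x => f x + c * g x) ^+ 2 =
  norm_L2 D f ^+ 2
  + 2 * (complex.Re c * complex.Re (inner_L2 D f g)
         + complex.Im c * complex.Im (inner_L2 D f g))
  + sqmod c * norm_L2 D g ^+ 2.
Proof.
move=> Lf Lg; have [ir ii] := in_L2M Lf (in_L2J Lg).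
have [[_ _ nf] [_ _ ng]] := (Lf, Lg).
rewrite !sqr_norm_L2 /inner_L2 !cintegral_parts.
pose r x := complex.Re (f x * (g x)^*); pose i x := complex.Im (f x * (g x)^*).
rewrite (@eq_Rintegral_leb2 _ (fun x => sqmod (f x) +
  (2 * complex.Re c * r x + (2 * complex.Im c * i x + sqmod c * sqmod (g x))))); last first.
  by move=> x; rewrite /r /i /sqmod !complex_parts; ring.
have iX := @real_integrableZ (2 * complex.Re c) r ir.
have iY := @real_integrableZ (2 * complex.Im c) i ii.
have iZ := real_integrableZ (sqmod c) ng.
have iYZ := real_integrableD iY iZ; have iXYZ := real_integrableD iX iYZ.
rewrite (RintegralD mD nf iXYZ) (RintegralD mD iX iYZ) (RintegralD mD iY iZ).
rewrite (RintegralZl _ mD ir) (RintegralZl _ mD ii) (RintegralZl _ mD ng) /r /i; ring.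
Qed.

(** Half of the parallelogram identity: |f - c g|^2 is dropped from
    |f + c g|^2 + |f - c g|^2. *)
Lemma sqr_norm_lincomb_le (c : R[i]) f g : in_L2 D f -> in_L2 D g ->
  norm_L2 D (fun x => f x + c * g x) ^+ 2 <=
  2 * (norm_L2 D f ^+ 2 + sqmod c * norm_L2 D g ^+ 2).
Proof.
move=> Lf Lg; rewrite (sqr_norm_lincomb c Lf Lg).
have := sqr_ge0 (norm_L2 D (fun x => f x + (- c) * g x)).
rewrite (sqr_norm_lincomb (- c) Lf Lg) /sqmod; move: (inner_L2 D f g) => z.
by rewrite cReN cImN; lra.
Qed.

Lemma norm_L2_eq0 f : in_L2 D f -> norm_L2 D f = 0 <-> zero_L2 D f.
Proof.
move=> [mr mi fi].
have mf : measurable_fun D (EFin \o (fun x => sqmod (f x))) by case/integrableP: fi.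
have e : (\int[leb2]_(x in D) `|(EFin \o (fun x => sqmod (f x))) x| =
    (norm_L2 D f ^+ 2)%:E)%E.
  rewrite sqr_norm_L2 /Rintegral fineK; last exact: integrable_fin_num.
  by apply: eq_integral => x _; rewrite gee0_abs// lee_fin sqmod_ge0.
have aeF := ae_filter_ringOfSetsType leb2.
have P := ae_eq_integral_abs leb2 mD mf; rewrite e in P.
split=> [n0|z0].
  have /P : ((norm_L2 D f ^+ 2)%:E = 0)%E by rewrite n0 expr0n.
  by apply: filterS => x fx0 Dx; apply: sqmod_eq0; case: (fx0 Dx).
have : ((norm_L2 D f ^+ 2)%:E = 0)%E.
  apply/P; apply: filterS z0 => x fx0 Dx /=; rewrite fx0//.
  by rewrite /sqmod /= expr0n addr0.
by move=> [] /eqP; rewrite sqrf_eq0 => /eqP.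
Qed.

End L2.

(** * Test functions *)

Section TestFunctions.
Context {R : realType}.
Local Notation plane := (R * R)%type.
Local Notation mplane := (measurableTypeR R * measurableTypeR R)%type.
Implicit Types (h : plane -> R) (f g : plane -> R[i]) (D : set plane) (k : 'I_2).

Lemma is_derive_lincomb (s t : R) h1 h2 (x v : plane) :
  derivable h1 x v -> derivable h2 x v ->
  is_derive x v (fun y => s * h1 y + t * h2 y) (s * 'D_v h1 x + t * 'D_v h2 x).
Proof.
move=> /derivableP d1 /derivableP d2.
exact: (is_deriveD (is_deriveZ s d1) (is_deriveZ t d2)).
Qed.

Lemma Ck_fun_lincomb n (s t : R) h1 h2 : Ck_fun n h1 -> Ck_fun n h2 ->
  Ck_fun n (fun y => s * h1 y + t * h2 y).
Proof.
have cont (g1 g2 : plane -> R) : continuous g1 -> continuous g2 ->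
    continuous (fun y => s * g1 y + t * g2 y).
  move=> c1 c2 x; apply: cvgD; apply: cvgM; try exact: cvg_cst.
    exact: c1.
  exact: c2.
elim: n h1 h2 => [|n IH] h1 h2 /=; first exact: cont.
move=> [c1 d1] [c2 d2]; split; first exact: cont.
move=> k; have [e1 s1] := d1 k; have [e2 s2] := d2 k.
have D12 x := is_derive_lincomb s t (e1 x) (e2 x).
split; first by move=> x; have := D12 x => -[].
rewrite (_ : 'D_(axis k) _ =
  fun x => s * 'D_(axis k) h1 x + t * 'D_(axis k) h2 x); first exact: IH.
by apply/funext => x; have [_ ->] := D12 x.
Qed.

(** The eigenvalue of [squeeze a] in the direction [axis k]. *)
Definition stretch (a : R) k : R := if k == 0 then a else a^-1.

Lemma stretch_neq0 a k : 0 < a -> stretch a k != 0.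
Proof. by rewrite /stretch => a0; case: ifP => _; rewrite ?invr_eq0 gt_eqF. Qed.

Lemma stretch_ge0 a k : 0 < a -> 0 <= stretch a k.
Proof. by rewrite /stretch => a0; case: ifP => _; rewrite ?invr_ge0 ltW. Qed.

Lemma squeeze_shift (a r : R) k (x : plane) :
  squeeze a (r *: axis k + x) = (r * stretch a k) *: axis k + squeeze a x.
Proof.
case: x => x y; rewrite /squeeze /stretch /axis.
case: ifP => _; rewrite [RHS]surjective_pairing /= /GRing.scale/=;
by congr pair; ring.
Qed.

(** The reparametrisation behind the chain rule of [is_derive_squeeze]. *)
Lemma mulr_dnbhs0 (s : R) : s != 0 -> (fun r : R => r * s) @ 0^' --> 0^'.
Proof.
move=> s0 A [/= e e0 eA]; exists (e / `|s|); first by rewrite /= divr_gt0 ?normr_gt0.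
move=> r /=; rewrite sub0r normrN ltr_pdivlMr ?normr_gt0// => re r0.
by apply: eA; rewrite /= ?mulf_neq0// sub0r normrN normrM.
Qed.

(** [squeeze a] multiplies each coordinate direction by a constant, so the
    difference quotients of [h \o squeeze a] are, up to that constant, those of
    [h] in the same direction at a rescaled increment. *)
Lemma is_derive_squeeze (a : R) k h (x : plane) : 0 < a ->
  derivable h (squeeze a x) (axis k) ->
  is_derive x (axis k) (h \o squeeze a) (stretch a k * 'D_(axis k) h (squeeze a x)).
Proof.
move=> a0 dh; set s := stretch a k; have s0 : s != 0 by exact: stretch_neq0.
have : (fun r => r^-1 *: (((h \o squeeze a) \o shift x) (r *: axis k)
    - (h \o squeeze a) x)) @ 0^' --> s * 'D_(axis k) h (squeeze a x).
  have lim := cvg_comp _ _ (mulr_dnbhs0 s0) dh.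
  rewrite [X in X @ _](_ : _ = fun r => s * ((r * s)^-1 *:
      ((h \o shift (squeeze a x)) ((r * s) *: axis k) - h (squeeze a x)))).
    by apply: cvgM; [exact: cvg_cst | exact: lim].
  apply/funext => r /=.
  rewrite squeeze_shift -/s /GRing.scale/= invfM.
  by rewrite !mulrA (mulrAC s) mulfV// mul1r.
by move=> l; split; [apply/cvg_ex; exists (s * 'D_(axis k) h (squeeze a x))|exact: cvg_lim l].
Qed.

Lemma Ck_fun_squeeze n (a : R) h : 0 < a -> Ck_fun n h -> Ck_fun n (h \o squeeze a).
Proof.
move=> a0; have cont (g : plane -> R) : continuous g -> continuous (g \o squeeze a).
  by move=> cg x; apply: continuous_comp; [exact: squeeze_continuous|exact: cg].
elim: n h => [|n IH] h /=; first exact: cont.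
move=> [ch dh]; split; first exact: cont.
move=> k; have [eh sh] := dh k.
have DS x := is_derive_squeeze a0 (eh (squeeze a x)).
split; first by move=> x; have := DS x => -[].
(* The zero term puts the derivative in the form of [Ck_fun_lincomb]. *)
rewrite (_ : 'D_(axis k) _ = fun x => stretch a k * ('D_(axis k) h \o squeeze a) x
  + 0 * ('D_(axis k) h \o squeeze a) x); first by apply: Ck_fun_lincomb; exact: IH.
by apply/funext => x; have [_ ->] := DS x; rewrite mul0r addr0.
Qed.

Lemma test_fun_continuous D f : test_fun D f ->
  continuous (fun x => complex.Re (f x)) /\ continuous (fun x => complex.Im (f x)).
Proof. by case=> /(_ 0). Qed.

Lemma test_fun_partial D k f : test_fun D f ->
  [/\ forall x, derivable (fun y => complex.Re (f y)) x (axis k),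
      forall x, derivable (fun y => complex.Im (f y)) x (axis k),
      continuous (fun x => complex.Re (cpartial k f x)) &
      continuous (fun x => complex.Im (cpartial k f x))].
Proof.
case=> /(_ 1) [[_ /(_ k)[dr cr]] [_ /(_ k)[di ci]]] _ _.
by split; [exact: dr|exact: di|exact: cr|exact: ci].
Qed.

Lemma Re_cpartial k f x :
  complex.Re (cpartial k f x) = 'D_(axis k) (fun y => complex.Re (f y)) x.
Proof. by []. Qed.
Lemma Im_cpartial k f x :
  complex.Im (cpartial k f x) = 'D_(axis k) (fun y => complex.Im (f y)) x.
Proof. by []. Qed.
Definition cpartial_parts := (Re_cpartial, Im_cpartial).

(** Differentiability of both functions is essential: the directional derivative
    of a non-differentiable function is an arbitrary value. *)
Lemma cpartial_lincomb D k (c : R[i]) f g : test_fun D f -> test_fun D g ->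
  cpartial k (fun x => f x + c * g x) = fun x => cpartial k f x + c * cpartial k g x.
Proof.
move=> /(test_fun_partial k)[fr fi _ _] /(test_fun_partial k)[gr gi _ _].
have D3 (s t : R) h1 h2 h3 (x : plane) :
    derivable h1 x (axis k) -> derivable h2 x (axis k) -> derivable h3 x (axis k) ->
    'D_(axis k) (fun y => 1 * h1 y + 1 * (s * h2 y + t * h3 y)) x =
    'D_(axis k) h1 x + (s * 'D_(axis k) h2 x + t * 'D_(axis k) h3 x).
  move=> d1 d2 d3; have [d23 e23] := is_derive_lincomb s t d2 d3.
  by have [_ ->] := is_derive_lincomb 1 1 d1 d23; rewrite e23 !mul1r.
apply/funext => x; apply: complex_ext; rewrite !(complex_parts, cpartial_parts).
  rewrite -mulNr -D3//; congr ('D_(axis k) _ x).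
  by apply/funext => y; rewrite !complex_parts; ring.
rewrite -D3//; congr ('D_(axis k) _ x).
by apply/funext => y; rewrite !complex_parts; ring.
Qed.

Lemma cpartial_squeeze D (a : R) k f : 0 < a -> test_fun D f ->
  cpartial k (f \o squeeze a) =
  fun x => (stretch a k)%:C * cpartial k f (squeeze a x).
Proof.
move=> a0 /(test_fun_partial k)[fr fi _ _].
apply/funext => x; apply: complex_ext;
  rewrite !(complex_parts, cpartial_parts) mul0r ?subr0 ?addr0.
  by have [_ <-] := is_derive_squeeze a0 (fr (squeeze a x)).
by have [_ <-] := is_derive_squeeze a0 (fi (squeeze a x)).
Qed.

Lemma test_fun_lincomb D (c : R[i]) f g : test_fun D f -> test_fun D g ->
  test_fun D (fun x => f x + c * g x).
Proof.
move=> [fC fK fD] [gC gK gD].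
have sub : closure [set x | f x + c * g x != 0] `<=`
    closure [set x | f x != 0] `|` closure [set x | g x != 0].
  rewrite -closureU; apply: closure_subset => x /= fg0.
  have [f0|] := eqVneq (f x) 0; last by left.
  by right; apply: contraNneq fg0 => ->; rewrite f0 mulr0 addr0.
split.
- move=> n; have [fr fi] := fC n; have [gr gi] := gC n; split.
    have := Ck_fun_lincomb 1 1 fr (Ck_fun_lincomb (complex.Re c) (- complex.Im c) gr gi).
    by congr (Ck_fun n _); apply/funext => x; rewrite !complex_parts; ring.
  have := Ck_fun_lincomb 1 1 fi (Ck_fun_lincomb (complex.Re c) (complex.Im c) gi gr).
  by congr (Ck_fun n _); apply/funext => x; rewrite !complex_parts; ring.
- by apply: (subclosed_compact _ _ sub); [exact: closed_closure|exact: compactU].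
- by move=> x /sub[/fD|/gD].
Qed.

Lemma test_fun_squeeze D (a : R) f : 0 < a -> test_fun D f ->
  test_fun (squeeze a @^-1` D) (f \o squeeze a).
Proof.
move=> a0 [fC fK fD].
have sub : closure [set x | (f \o squeeze a) x != 0] `<=`
    squeeze a @^-1` closure [set x | f x != 0].
  have /closure_id -> : closed (squeeze a @^-1` closure [set x | f x != 0]).
    by apply: preimage_closed => [x _|]; [exact: (@squeeze_continuous R a x)|exact: closed_closure].
  by apply: closure_subset => x fx; exact: (@subset_closure _ [set y | f y != 0] (squeeze a x)).
split.
- by move=> n; have [fr fi] := fC n; split;
  [exact: (Ck_fun_squeeze a0 fr)|exact: (Ck_fun_squeeze a0 fi)].
- apply: (subclosed_compact _ _ sub); first exact: closed_closure.
  have -> : squeeze a @^-1` closure [set x | f x != 0] =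
      squeeze a^-1 @` closure [set x | f x != 0].
    apply/seteqP; split=> [x /= fx|_ [x fx <-]].
      by exists (squeeze a x) => //; rewrite squeezeK.
    by rewrite /preimage/= squeezeVK.
  apply: continuous_compact fK; apply: continuous_subspaceT.
  by move=> x; exact: (@squeeze_continuous R a^-1 x).
- by move=> x /sub /fD.
Qed.

Lemma continuous_bounded_Omega (a : R) h : continuous h ->
  exists M, forall x, Omega a x -> `|h x| <= M.
Proof.
move=> ch; pose K : set plane :=
  `[- (a / 2), a / 2] `*` `[- (2 * a)^-1, (2 * a)^-1].
have cK : compact K by apply: compact_setX; exact: segment_compact.
have : compact (h @` K) by apply: continuous_compact => //; exact: continuous_subspaceT.
move=> /compact_bounded [M [_ MP]]; exists (M + 1) => x [x1 x2].
apply: (MP (M + 1)); first by rewrite ltrDl.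
exists x => //; split; exact: subset_itv_oo_cc.
Qed.

(** The rectangle has compact closure, on which a continuous function of the
    plane is bounded; this treats test functions and their partial derivatives
    alike. *)
Lemma continuous_in_L2 (a : R) f :
  continuous (fun x => complex.Re (f x)) -> continuous (fun x => complex.Im (f x)) ->
  in_L2 (Omega a) f.
Proof.
have rL2 (h : plane -> R) : continuous h -> real_L2 (Omega a : set mplane) h.
  move=> ch; have [M hM] := continuous_bounded_Omega a ch.
  have mh := continuous_measurable_plane (D := Omega a) ch.
  split => //; apply: measurable_bounded_integrable.
  - exact: measurable_Omega.
  - exact: leb2_Omega.
  - exact: measurable_funX.
  - exists (M ^+ 2); split; first exact: num_real.
    move=> y My x Ox /=; apply: le_trans (ltW My).
    rewrite ger0_norm ?sqr_ge0// -(real_normK (num_real (h x))).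
    by rewrite lerXn2r ?nnegrE ?hM// (le_trans _ (hM x Ox)).
move=> cr ci; apply/(in_L2P (@measurable_Omega R a)); split; exact: rL2.
Qed.

Lemma test_fun_L2 (a : R) D f : test_fun D f -> in_L2 (Omega a) f.
Proof. by move=> /test_fun_continuous[]; exact: continuous_in_L2. Qed.

Lemma cpartial_L2 (a : R) D k f : test_fun D f -> in_L2 (Omega a) (cpartial k f).
Proof. by move=> /(test_fun_partial k)[_ _]; exact: continuous_in_L2. Qed.

End TestFunctions.

(** * Linearity and change of variables for L2 norms and integrals *)

Section L2Squeeze.
Context {R : realType}.
Local Notation plane := (R * R)%type.
Local Notation mplane := (measurableTypeR R * measurableTypeR R)%type.
Variables (D : set mplane) (mD : measurable D).
Implicit Types (f g : plane -> R[i]).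

Lemma in_L2B f g : in_L2 D f -> in_L2 D g -> in_L2 D (fun x => f x - g x).
Proof.
move=> Lf Lg; have := in_L2_lincomb mD (-1) Lf Lg.
by under [X in in_L2 D X]funext do rewrite mulN1r.
Qed.

Lemma cintegralZ (c : R[i]) f : cintegrable D f ->
  cintegral D (fun x => c * f x) = c * cintegral D f.
Proof.
(* c f = f + (c - 1) f *)
move=> fi; have := cintegral_lincomb mD (c - 1) fi fi.
rewrite mulrBl mul1r subrKC => <-.
by congr cintegral; apply/funext => x; rewrite mulrBl mul1r subrKC.
Qed.

Lemma inner_L2Zl (c : R[i]) f g : in_L2 D f -> in_L2 D g ->
  inner_L2 D (fun x => c * f x) g = c * inner_L2 D f g.
Proof.
move=> Lf Lg; rewrite /inner_L2 -cintegralZ; last exact: (in_L2M mD Lf (in_L2J mD Lg)).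
by congr cintegral; apply/funext => x; rewrite mulrA.
Qed.

Lemma norm_L2_lincomb_le (c : R[i]) f g : in_L2 D f -> in_L2 D g ->
  norm_L2 D (fun x => f x + c * g x) <=
  2 * norm_L2 D f + 2 * Num.sqrt (sqmod c) * norm_L2 D g.
Proof.
move=> Lf Lg; have := sqr_norm_lincomb_le mD c Lf Lg.
rewrite -{1}(sqr_sqrtr (sqmod_ge0 c)) -exprMn => h.
have f0 := norm_L2_ge0 D f; have g0 := norm_L2_ge0 D g.
have m0 := mulr_ge0 (sqrtr_ge0 (sqmod c)) g0.
rewrite -mulrA -(@ler_pXn2r _ 2) ?nnegrE ?norm_L2_ge0 ?addr_ge0 ?mulr_ge0//.
by apply: le_trans h _; nra.
Qed.

Lemma norm_L2Z (r : R) f : 0 <= r -> in_L2 D f ->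
  norm_L2 D (fun x => r%:C * f x) = r * norm_L2 D f.
Proof.
move=> r0 [_ _ fi]; apply/eqP.
rewrite -(@eqrXn2 _ 2) ?norm_L2_ge0 ?mulr_ge0 ?norm_L2_ge0// exprMn !sqr_norm_L2.
rewrite -(RintegralZl _ mD fi); apply/eqP; apply: eq_Rintegral_leb2 => x.
by rewrite /sqmod !complex_parts; ring.
Qed.

Variables (a : R) (a0 : 0 < a).
Local Notation E := (squeeze a @^-1` D).

Lemma cintegral_squeeze f : cintegrable D f ->
  cintegral E (f \o squeeze a) = cintegral D f.
Proof.
move=> [/integrableP[/measurable_EFinP mr _] /integrableP[/measurable_EFinP mi _]].
by apply: complex_ext; rewrite !cintegral_parts;
  [exact: (Rintegral_squeeze a0 mD mr)|exact: (Rintegral_squeeze a0 mD mi)].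
Qed.

Lemma in_L2_squeeze f : in_L2 D f -> in_L2 E (f \o squeeze a).
Proof.
move=> [mr mi fi]; split.
- exact: (measurable_fun_squeeze mD mr).
- exact: (measurable_fun_squeeze mD mi).
- exact: (integrable_squeeze a0 mD fi).
Qed.

Lemma norm_L2_squeeze f : in_L2 D f -> norm_L2 E (f \o squeeze a) = norm_L2 D f.
Proof.
move=> [_ _ /integrableP[/measurable_EFinP mf _]].
by rewrite /norm_L2; congr Num.sqrt; exact: (Rintegral_squeeze a0 mD mf).
Qed.

End L2Squeeze.

(** * Stability of the Sobolev space *)

Section Sobolev.
Context {R : realType}.
Local Notation plane := (R * R)%type.

(** The approximating test functions are combined in the same way; the weak
    derivative identity is linear because a test function and its partial
    derivatives are square-integrable on the rectangle, which makes all the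
    integrals involved absolutely convergent. *)
Lemma W012_lincomb (a : R) (c : R[i]) (u v : W012 (Omega a)) :
  exists w : W012 (Omega a),
    (wfun w = fun x => u x + c * v x) /\
    (forall k, wgrad w k = fun x => wgrad u k x + c * wgrad v k x).
Proof.
have mO := @measurable_Omega R a.
have [phi [phiT phi0 phi1]] := wfun_closure u.
have [psi [psiT psi0 psi1]] := wfun_closure v.
have conv (F G : nat -> plane -> R[i]) :
    (forall n, in_L2 (Omega a) (F n)) -> (forall n, in_L2 (Omega a) (G n)) ->
    norm_L2 (Omega a) (F n) @[n --> \oo] --> 0 ->
    norm_L2 (Omega a) (G n) @[n --> \oo] --> 0 ->
    norm_L2 (Omega a) (fun x => F n x + c * G n x) @[n --> \oo] --> 0.
  move=> LF LG F0 G0.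
  apply: (@squeeze_cvgr _ _ _ _ (fun=> 0) (fun n => 2 * norm_L2 (Omega a) (F n)
    + 2 * Num.sqrt (sqmod c) * norm_L2 (Omega a) (G n))).
  - by apply: nearW => n; rewrite norm_L2_ge0 norm_L2_lincomb_le.
  - exact: cvg_cst.
  - rewrite -[0 in X in _ --> X]addr0 -[X in _ --> X + _](mulr0 2).
    rewrite -[X in _ --> _ + X](mulr0 (2 * Num.sqrt (sqmod c))).
    by apply: cvgD; apply: cvgM => //; exact: cvg_cst.
unshelve eexists.
  apply: (@MkW012 R (Omega a) (fun x => u x + c * v x)
    (fun k x => wgrad u k x + c * wgrad v k x)).
  - by apply: (in_L2_lincomb mO); exact: wfun_L2.
  - by move=> k; apply: (in_L2_lincomb mO); exact: wgrad_L2.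
  - move=> k f Tf; have Lf := test_fun_L2 a Tf; have Lpf := cpartial_L2 a k Tf.
    transitivity (cintegral (Omega a) (fun x => u x * cpartial k f x +
        c * (v x * cpartial k f x))).
      by congr cintegral; apply/funext => x; rewrite mulrDl mulrA.
    rewrite (cintegral_lincomb mO); try by apply: in_L2M => //; exact: wfun_L2.
    rewrite !wgrad_weak// mulrN -opprD; congr (- _).
    rewrite -(cintegral_lincomb mO); try by apply: in_L2M => //; exact: wgrad_L2.
    by congr cintegral; apply/funext => x; rewrite mulrDl mulrA.
  - exists (fun n x => phi n x + c * psi n x); split.
    + by move=> n; exact: test_fun_lincomb.
    + have := conv (fun n x => phi n x - u x) (fun n x => psi n x - v x) _ _ phi0 psi0.
      have Lp n := in_L2B mO (test_fun_L2 a (phiT n)) (wfun_L2 u).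
      have Lq n := in_L2B mO (test_fun_L2 a (psiT n)) (wfun_L2 v).
      move=> /(_ Lp Lq); under [X in X @ _]funext => n.
        under [X in norm_L2 _ X]funext => x do rewrite mulrBr addrACA -opprD.
        over.
      by [].
    + move=> k.
      have := conv (fun n x => cpartial k (phi n) x - wgrad u k x)
        (fun n x => cpartial k (psi n) x - wgrad v k x) _ _ (phi1 k) (psi1 k).
      have Lp n := in_L2B mO (cpartial_L2 a k (phiT n)) (wgrad_L2 u k).
      have Lq n := in_L2B mO (cpartial_L2 a k (psiT n)) (wgrad_L2 v k).
      move=> /(_ Lp Lq); under [X in X @ _]funext => n.
        under [X in norm_L2 _ X]funext => x do rewrite mulrBr addrACA -opprD.
        over.
      under [X in _ -> X @ _ --> _]funext => n.
        rewrite (cpartial_lincomb k c (phiT n) (psiT n)). over.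
      by [].
by split.
Qed.

(** Composition with [squeeze a] pulls u back from the rectangle to the square.
    A test function f on the square is psi o S with psi = f o S^-1 a test
    function on the rectangle, and the weak derivative identity for u against
    psi becomes, after the change of variables, the one for u o S against f. *)
Lemma W012_squeeze (a : R) (u : W012 (Omega a)) : 0 < a ->
  exists w : W012 (Omega 1),
    (wfun w = u \o squeeze a) /\
    (forall k, wgrad w k = fun x => (stretch a k)%:C * wgrad u k (squeeze a x)).
Proof.
move=> a0; have mO := @measurable_Omega R a.
have Oa := squeeze_Omega a0.
have s0 k := stretch_ge0 k a0.
have [phi [phiT phi0 phi1]] := wfun_closure u.
(* On the preimage of the rectangle the change of variables applies verbatim. *)
rewrite -Oa.
unshelve eexists.
  apply: (@MkW012 R _ (u \o squeeze a)
    (fun k x => (stretch a k)%:C * wgrad u k (squeeze a x))).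
  - by apply: (in_L2_squeeze mO) => //; exact: wfun_L2.
  - move=> k; apply: (in_L2Z (measurable_preimage_squeeze a mO)).
    by apply: (in_L2_squeeze mO) => //; exact: wgrad_L2.
  - move=> k f Tf; set psi := f \o squeeze a^-1.
    have Tpsi : test_fun (Omega a) psi.
      have ia0 : 0 < a^-1 by rewrite invr_gt0.
      have := test_fun_squeeze ia0 Tf; rewrite -/psi; congr (test_fun _ _).
      by apply/seteqP; split => x; rewrite /preimage/= squeezeVK.
    have fE : f = psi \o squeeze a by apply/funext => x; rewrite /psi/= squeezeK.
    have Lpsi := test_fun_L2 a Tpsi; have Lpk := cpartial_L2 a k Tpsi.
    have scale (F G : plane -> R[i]) : in_L2 (Omega a) F -> in_L2 (Omega a) G ->
        cintegral (squeeze a @^-1` Omega a)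
          (fun x => (stretch a k)%:C * (F (squeeze a x) * G (squeeze a x))) =
        (stretch a k)%:C * cintegral (Omega a) (fun x => F x * G x).
      move=> LF LG; rewrite -(cintegral_squeeze mO a0 (in_L2M mO LF LG)).
      apply: cintegralZ; first exact: measurable_preimage_squeeze.
      apply: in_L2M; first exact: measurable_preimage_squeeze.
        exact: (in_L2_squeeze mO a0 LF).
      exact: (in_L2_squeeze mO a0 LG).
    transitivity ((stretch a k)%:C * cintegral (Omega a) (fun x => u x * cpartial k psi x)).
      rewrite -scale//; last exact: wfun_L2.
      rewrite fE (cpartial_squeeze k a0 Tpsi).
      by congr cintegral; apply/funext => x /=; rewrite mulrCA.
    rewrite wgrad_weak// mulrN -scale//; last exact: wgrad_L2.
    by congr (- cintegral _ _); apply/funext => x; rewrite fE /= mulrA.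
  - exists (fun n => phi n \o squeeze a); split.
    + by move=> n; exact: test_fun_squeeze.
    + have Lp n := in_L2B mO (test_fun_L2 a (phiT n)) (wfun_L2 u).
      under [X in X @ _]funext => n do
        rewrite (norm_L2_squeeze mO a0 (Lp n)).
      exact: phi0.
    + move=> k.
      have Lp n := in_L2B mO (cpartial_L2 a k (phiT n)) (wgrad_L2 u k).
      have e n : norm_L2 (squeeze a @^-1` Omega a) (fun x =>
            cpartial k (phi n \o squeeze a) x - (stretch a k)%:C * wgrad u k (squeeze a x))
          = stretch a k * norm_L2 (Omega a) (fun x => cpartial k (phi n) x - wgrad u k x).
        rewrite (cpartial_squeeze k a0 (phiT n)) -(norm_L2_squeeze mO a0 (Lp n)).
        rewrite -norm_L2Z//; last exact: in_L2_squeeze.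
          by congr norm_L2; apply/funext => x /=; rewrite mulrBr.
        exact: measurable_preimage_squeeze.
      under [X in X @ _]funext => n do rewrite e.
      suff : stretch a k * norm_L2 (Omega a) (fun x => cpartial k (phi n) x
          - wgrad u k x) @[n --> \oo] --> stretch a k * 0 by rewrite mulr0.
      by apply: cvgM; [exact: cvg_cst|exact: phi1].
by split.
Qed.

End Sobolev.

(** * Comparison of both eigenvalues with mu *)

Section Magnetic.
Context {R : realType}.
Variable B : R.

Lemma potential_continuous k : continuous (potential B k).
Proof.
rewrite /potential; case: (k == 0) => x; apply: cvgM; try exact: cvg_cst.
  by apply: cvgN; exact: cvg_snd.
exact: cvg_fst.
Qed.

Lemma mag_partial_L2 (a : R) k (u : W012 (Omega a)) :
  in_L2 (Omega a) (mag_partial B k u).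
Proof.
have mO := @measurable_Omega R a.
have [M hM] := continuous_bounded_Omega a (@potential_continuous k).
apply: (in_L2B mO); first exact: wgrad_L2.
have im x : complex.Im ('i * (potential B k x)%:C) = potential B k x.
  by rewrite !complex_parts; ring.
have re x : complex.Re ('i * (potential B k x)%:C) = 0.
  by rewrite !complex_parts; ring.
apply: (in_L2_bounded mO (M := M)); last exact: wfun_L2.
- by rewrite (funext re); exact: measurable_cst.
- rewrite (funext im).
  by apply: continuous_measurable_plane; exact: potential_continuous.
- by move=> x Ox; rewrite re normr0 (le_trans _ (hM x Ox)).
- by move=> x Ox; rewrite im; exact: hM.
Qed.

Lemma mag_partial_lincomb (a : R) (c : R[i]) k (u v w : W012 (Omega a)) :
  wfun w = (fun x => u x + c * v x) ->
  (forall k, wgrad w k = fun x => wgrad u k x + c * wgrad v k x) ->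
  mag_partial B k w = fun x => mag_partial B k u x + c * mag_partial B k v x.
Proof.
move=> wE wgE; apply/funext => x; rewrite /mag_partial wE wgE.
by apply: complex_ext; rewrite !complex_parts; ring.
Qed.

(** The point where the symmetric gauge is used: its first component involves
    only x_2, which S divides by a, so it picks up the same factor a as the first
    partial derivative, and symmetrically for the second. *)
Lemma mag_partial_squeeze (a : R) k (u : W012 (Omega a)) (w : W012 (Omega 1)) :
  0 < a -> wfun w = u \o squeeze a ->
  (forall k, wgrad w k = fun x => (stretch a k)%:C * wgrad u k (squeeze a x)) ->
  mag_partial B k w = fun x => (stretch a k)%:C * mag_partial B k u (squeeze a x).
Proof.
move=> a0 wE wgE; apply/funext => x; rewrite /mag_partial wE wgE /=.
have -> : potential B k x = stretch a k * potential B k (squeeze a x).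
  by rewrite /potential /stretch /squeeze; case: ifP => _ /=; field; rewrite gt_eqF.
by apply: complex_ext; rewrite !complex_parts; ring.
Qed.

Lemma mag_formE (a : R) (u v : W012 (Omega a)) : mag_form B u v =
  inner_L2 (Omega a) (mag_partial B 0 u) (mag_partial B 0 v) +
  inner_L2 (Omega a) (mag_partial B 1 u) (mag_partial B 1 v).
Proof.
rewrite /mag_form big_ord_recl big_ord1.
by have -> : lift ord0 ord0 = 1 :> 'I_2 by exact: val_inj.
Qed.

Lemma norm_L2_gt0 (a : R) (u : W012 (Omega a)) :
  ~ zero_L2 (Omega a) u -> 0 < norm_L2 (Omega a) u.
Proof.
move=> nz; rewrite lt_neqAle norm_L2_ge0 andbT eq_sym; apply/eqP => n0; apply: nz.
by apply/(norm_L2_eq0 (@measurable_Omega R a)) => //; exact: wfun_L2.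
Qed.

Lemma nonzero_of_norm_gt0 (a : R) (u : W012 (Omega a)) :
  0 < norm_L2 (Omega a) u -> ~ zero_L2 (Omega a) u.
Proof.
move=> n0 /(norm_L2_eq0 (@measurable_Omega R a) (wfun_L2 u)) e.
by rewrite e ltxx in n0.
Qed.

(** Stated without division, so that it also covers functions that vanish almost
    everywhere. *)
Lemma mu_le (u : W012 (Omega 1)) : mu B * norm_L2 (Omega 1) u ^+ 2 <=
  2 * norm_L2 (Omega 1) (mag_partial B 0 u) * norm_L2 (Omega 1) (mag_partial B 1 u).
Proof.
have q0 (v : W012 (Omega 1)) : 0 <= mu_quotient B v.
  by rewrite /mu_quotient divr_ge0 ?sqr_ge0// !mulr_ge0// norm_L2_ge0.
have := norm_L2_ge0 (Omega 1) u; rewrite le_eqVlt => /orP[/eqP <-|u0].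
  by rewrite expr0n mulr0 !mulr_ge0 ?norm_L2_ge0.
rewrite -ler_pdivlMr ?exprn_gt0//; apply: ge_inf.
  by exists 0 => _ [v _ ->].
by exists u => //; exact: nonzero_of_norm_gt0.
Qed.

(** Testing the eigenvalue equation with u itself gives l |u|^2 as the sum of
    squares of |d_1 u| and |d_2 u|; this dominates their double product, which is
    invariant under the squeeze. *)
Lemma mu_le_eigenvalue (a l : R) : 0 < a -> mag_eigenvalue B (Omega a) l -> mu B <= l.
Proof.
move=> a0 [u [nz [_ eig]]]; have mO := @measurable_Omega R a.
have u0 := norm_L2_gt0 nz.
have e : norm_L2 (Omega a) (mag_partial B 0 u) ^+ 2 +
    norm_L2 (Omega a) (mag_partial B 1 u) ^+ 2 = l * norm_L2 (Omega a) u ^+ 2.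
  have := congr1 (@complex.Re R) (eig u).
  rewrite mag_formE (inner_L2Zl mO); [|exact: wfun_L2..].
  by rewrite !inner_L2_norm// cReD cReZ !cReR.
have [w [wE wgE]] := W012_squeeze u a0.
have := mu_le w.
have nw : norm_L2 (Omega 1) w = norm_L2 (Omega a) u.
  by rewrite wE -(squeeze_Omega a0) (norm_L2_squeeze mO)//; exact: wfun_L2.
have s0 k := stretch_ge0 k a0.
have nk k : norm_L2 (Omega 1) (mag_partial B k w) =
    stretch a k * norm_L2 (Omega a) (mag_partial B k u).
  rewrite (mag_partial_squeeze k a0 wE wgE) -(squeeze_Omega a0).
  rewrite -(norm_L2_squeeze mO a0 (@mag_partial_L2 a k u)) -norm_L2Z//.
    exact: measurable_preimage_squeeze.
  exact: (in_L2_squeeze mO a0 (@mag_partial_L2 a k u)).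
rewrite nw !nk => h; rewrite -(ler_pM2r (exprn_gt0 2 u0)) -e.
apply: le_trans h _; rewrite /stretch /=.
set p := norm_L2 _ _; set q := norm_L2 _ _.
have -> : 2 * (a * p) * (a^-1 * q) = 2 * p * q by field; rewrite gt_eqF.
by have := sqr_ge0 (p - q); lra.
Qed.

Lemma quadratic_ge0_lin0 (p q : R) :
  (forall t : R, 0 <= t * p + t ^+ 2 * q) -> p = 0.
Proof.
move=> h.
have q0 : 0 <= q by have := h 1; have := h (-1); lra.
(* The minimum is at -p / (2 q); the denominator q + 1 avoids the case q = 0. *)
have := h (- p / (q + 1)); have q1 : 0 < q + 1 by lra.
rewrite expr_div_n.
have -> : - p / (q + 1) * p + (- p) ^+ 2 / (q + 1) ^+ 2 * q = - (p / (q + 1)) ^+ 2.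
  by field; rewrite gt_eqF.
rewrite oppr_ge0 => pq; apply/eqP.
have : (p / (q + 1)) ^+ 2 == 0 by rewrite eq_le pq sqr_ge0.
by rewrite sqrf_eq0 mulf_eq0 invr_eq0 (gt_eqF q1) orbF.
Qed.

(** Euler-Lagrange: the functional w |-> |d_1 w|^2 + |d_2 w|^2 - mu |w|^2 is
    nonnegative, because it dominates 2 |d_1 w| |d_2 w| - mu |w|^2, and it
    vanishes at u since there the two derivatives have the same norm.  Its first
    variation at u therefore vanishes in every direction v. *)
Lemma minimiser_eigenvalue (u : W012 (Omega 1)) : mu_minimiser B u ->
  norm_L2 (Omega 1) (mag_partial B 0 u) = norm_L2 (Omega 1) (mag_partial B 1 u) ->
  mag_eigenvalue B (Omega 1) (mu B).
Proof.
move=> [nz qE] bal; exists u; split; first exact: nz.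
have mO := @measurable_Omega R 1.
have u0 := norm_L2_gt0 nz.
split; first exact: (in_L2Z mO _ (wfun_L2 u)).
move=> v; rewrite (inner_L2Zl mO); [|exact: wfun_L2..].
have e : norm_L2 (Omega 1) (mag_partial B 0 u) ^+ 2 +
    norm_L2 (Omega 1) (mag_partial B 1 u) ^+ 2 = mu B * norm_L2 (Omega 1) u ^+ 2.
  by rewrite -qE /mu_quotient divfK ?expf_neq0 ?gt_eqF// bal; ring.
pose defect := mag_form B u v - (mu B)%:C * inner_L2 (Omega 1) u v.
(* The functional at u + c v equals 2 Re (conj(c) defect) + |c|^2 q. *)
pose q := norm_L2 (Omega 1) (mag_partial B 0 v) ^+ 2 +
  norm_L2 (Omega 1) (mag_partial B 1 v) ^+ 2 - mu B * norm_L2 (Omega 1) v ^+ 2.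
have var (c : R[i]) : 0 <= 2 * (complex.Re c * complex.Re defect
    + complex.Im c * complex.Im defect) + sqmod c * q.
  have [w [wE wgE]] := W012_lincomb c u v.
  have := mu_le w; have := sqr_ge0 (norm_L2 (Omega 1) (mag_partial B 0 w)
    - norm_L2 (Omega 1) (mag_partial B 1 w)).
  have L k := sqr_norm_lincomb mO c (mag_partial_L2 k u) (mag_partial_L2 k v).
  have Lw := sqr_norm_lincomb mO c (wfun_L2 u) (wfun_L2 v).
  move=> amgm; rewrite wE Lw => le_mu.
  have := L 0; have := L 1; rewrite -!(mag_partial_lincomb _ wE wgE) => n1 n0.
  move: n0 n1 le_mu amgm; rewrite /defect mag_formE /q.
  move: (inner_L2 _ (mag_partial B 0 u) _) (inner_L2 _ (mag_partial B 1 u) _).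
  move: (inner_L2 _ u v) => y x0 x1 n0 n1 le_mu amgm.
  by rewrite !(cReD, cImD, cReN, cImN, cReZ, cImZ); lra.
have defect0 : defect = 0.
  (* Real c isolates the real part of the defect, imaginary c the imaginary one;
     c = t / 2 absorbs the factor 2 of the linear term. *)
  apply: complex_ext; apply: (@quadratic_ge0_lin0 _ (q / 4)) => t.
    by have := var (t / 2)%:C; rewrite /sqmod /=; lra.
  by have := var (0 +i* (t / 2)); rewrite /sqmod /=; lra.
by apply/eqP; rewrite -subr_eq0; apply/eqP.
Qed.

End Magnetic.

Local Close Scope classical_set_scope.
Local Close Scope complex_scope.

Theorem theorem2 (R : realType)
  (Hmin : forall B : R, exists u : W012 (Omega (1 : R)),
     mu_minimiser B u /\
     norm_L2 (Omega 1) (mag_partial B 0 u) = norm_L2 (Omega 1) (mag_partial B 1 u))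
  (a : R) (a_gt0 : 0 < a) (B : R) :
  (lambda1 B (Omega 1) <= lambda1 B (Omega a))%E.
Proof.
have [u [umin ubal]] := Hmin B.
apply: (@le_trans _ _ (mu B)%:E).
  by apply: ereal_inf_lbound; exists (mu B) => //; exact: minimiser_eigenvalue ubal.
apply/ereal_infP => _ [l eig <-].
by rewrite lee_fin; exact: mu_le_eigenvalue eig.
Qed.
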